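(* Let $N=3$, $m_0(z)=\frac{1+z^2}{\sqrt2}$, and let $m$ be the measure on the solenoid $\mathcal{S}_3$ associated to $W=|m_0|^2/3$. Let $\mathbf{C}\subset[0,1]$ be the triadic Cantor set and $\mathcal{H}^s$ the Hausdorff measure of dimension $s=\log_32$. Then $$\hat m(\lambda)=\mathcal{H}^s\big((\mathbf{C}+\lambda)\cap\mathbf{C}\big)\qquad(\lambda\in\mathbb{Z}[1/3]),$$ where $\hat m(\lambda)=\int_{\mathcal{S}_3}\chi_\lambda\,dm$.
   Context: $\mathcal{H}^s$ is normalized in the standard way for which $\mathcal{H}^s(\mathbf{C})=1$. $\mathcal{S}_3=\{(z_n)_{n\in\mathbb{Z}}\mid z_{n+1}^3=z_n,\ |z_n|=1\}$ (elements are determined by $(z_n)_{n\ge0}$). For $\lambda=k/3^p\in\mathbb{Z}[1/3]$, $\chi_\lambda((z_n)_n)=z_p^k$. Functions $f$ on the unit circle are identified with functions on $[0,1)$ by $f(x):=f(e^{-2\pi i x})$. Measure $m$ associated to $W$ (here $W\ge0$ and $\sum_{k=0}^{2}W(\tau_kx)=1$, where $\tau_k(x)=\frac{x+k}{3}$): let $\Omega=\{0,1,2\}^{\{1,2,\dots\}}$. For $x\in[0,1)$, $P_x$ is the unique Borel probability measure on $\Omega$ such that, for $f$ depending only on $\omega_1,\dots,\omega_n$, $\int_\Omega f\,dP_x=\sum_{\omega_1,\dots,\omega_n}f(\omega_1,\dots,\omega_n)W(\tau_{\omega_1}x)W(\tau_{\omega_2}\tau_{\omega_1}x)\cdots W(\tau_{\omega_n}\cdots\tau_{\omega_1}x)$.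 With $\Phi(x,\omega)=(e^{-2\pi i x},e^{-2\pi i\tau_{\omega_1}x},e^{-2\pi i\tau_{\omega_2}\tau_{\omega_1}x},\dots)$ (coordinates $z_0,z_1,z_2,\dots$), a measurable bijection $[0,1)\times\Omega\to\mathcal{S}_3$, $m$ is the Borel probability measure on $\mathcal{S}_3$ with $\int f\,dm=\int_0^1\int_\Omega f(\Phi(x,\omega))\,dP_x(\omega)\,dx$ for $f\in C(\mathcal{S}_3)$. *)

(* Defs.v *)
From HB Require Import structures.
From mathcomp Require Import all_boot all_order all_algebra.
From mathcomp Require Import complex ring.
From mathcomp Require Import all_classical all_reals all_analysis.

Set Implicit Arguments.
Unset Strict Implicit.
Unset Printing Implicit Defensive.

Import Order.TTheory GRing.Theory Num.Theory.
Import numFieldNormedType.Exports.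

Local Open Scope classical_set_scope.
Local Open Scope ring_scope.
Local Open Scope complex_scope.

(* The topology of the norm, which the library attaches to [R[i]^o] only. *)
HB.instance Definition _ (R : realType) := PseudoPointedMetric.copy R[i] R[i]^o.
HB.instance Definition _ (R : realType) := NormedModule.copy R[i] R[i]^o.

(* [hausdorff s A] is the outer measure on the line without any normalizing
   constant in front of [diam ^ s]; for [s = log 2 / log 3] this is the
   normalization in which the Cantor set has measure 1.  The [0] added in
   [diam] only serves to give the empty set diameter 0; the dimension [s] is
   meant to be positive. *)
Definition diam {R : realType} (U : set R) : \bar R :=
  ereal_sup (0%E |` [set e | exists x y, [/\ U x, U y & e = `|x - y|%:E]]).

Definition hausdorff_pre {R : realType} (s delta : R) (A : set R) : \bar R :=
  ereal_inf [set e | exists U : nat -> set R,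
    [/\ A `<=` \bigcup_i U i, (forall i, (diam (U i) <= delta%:E)%E) &
        e = (\sum_(0 <= i <oo) poweR (diam (U i)) s)%E]].

Definition hausdorff {R : realType} (s : R) (A : set R) : \bar R :=
  ereal_sup [set hausdorff_pre s delta A | delta in [set d | 0 < d]].

Fixpoint cantor_stage {R : realType} (n : nat) : set R :=
  if n is n'.+1 then
    [set x / 3 | x in cantor_stage n'] `|` [set (x + 2) / 3 | x in cantor_stage n']
  else [set` `[0, 1]].

Definition cantor_set {R : realType} : set R := \bigcap_n cantor_stage n.

Definition translate {R : realType} (A : set R) (t : R) : set R :=
  [set x + t | x in A].

Definition solenoid_set (R : realType) : set (prod_topology (fun _ : int => R[i])) :=
  [set z | forall n : int, z (n + 1) ^+ 3 = z n /\ `|z n| = 1].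
Arguments solenoid_set : clear implicits.

Definition solenoid (R : realType) : Type := solenoid_set R.

HB.instance Definition _ (R : realType) := Topological.on (solenoid R).

Definition coord {R : realType} (z : solenoid R) (n : int) : R[i] := set_val z n.

Lemma solenoid_one_subproof (R : realType) :
  (fun _ : int => 1) \in solenoid_set R.
Proof. by rewrite inE /= => n; rewrite expr1n normr1. Qed.

HB.instance Definition _ (R : realType) :=
  isPointed.Build (solenoid R) 
    (exist (fun z => z \in solenoid_set R) _ (solenoid_one_subproof R)).

Definition solenoid_borel (R : realType) := g_sigma_algebraType (@open (solenoid R)).

(* The character of index [k / 3 ^ p]; [character3] shows that it depends only
   on that quotient. *)
Definition character {R : realType} (k : int) (p : nat) (z : solenoid R) : R[i] :=
  coord z p ^ k.

Lemma character3 (R : realType) (k : int) (p : nat) :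
  character (3 * k) p.+1 = character k p :> (solenoid R -> R[i]).
Proof.
apply/funext => z; rewrite /character -exprz_exp; congr (_ ^ k).
have /set_mem /(_ p%:Z) [+ _] := valP z.
by rewrite -PoszD addn1.
Qed.

Definition cintegral d (T : measurableType d) (R : realType)
    (mu : {measure set T -> \bar R}) (D : set T) (f : T -> R[i]) : R[i] :=
  (\int[mu]_(x in D) complex.Re (f x)) +i* (\int[mu]_(x in D) complex.Im (f x)).

(* exp(-2 i pi x): functions of [x] in [0, 1) and functions on the unit circle
   are identified through this map, hence the compositions [W (expn2pi _)]. *)
Definition expn2pi {R : realType} (x : R) : R[i] :=
  cos (2 * pi * x) -i* sin (2 * pi * x).

Definition tau {R : realType} (k : nat) (x : R) : R := (x + k%:R) / 3.

(* A sequence [w : nat -> 'I_3] has its first digit, usually indexed by 1,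
   at 0: [tau_iter w n x] is [tau (w n.-1) (... (tau (w 0) x))]. *)
Fixpoint tau_iter {R : realType} (w : nat -> 'I_3) (n : nat) (x : R) : R :=
  if n is n'.+1 then tau (w n') (tau_iter w n' x) else x.

Definition Omega : Type := prod_topology (fun _ : nat => discrete_topology 'I_3).
HB.instance Definition _ := Topological.on Omega.
HB.instance Definition _ := isPointed.Build Omega (fun=> ord0).

Definition Omega_borel := g_sigma_algebraType (@open Omega).

Definition is_path_measure {R : realType} (W : R[i] -> R) (x : R)
    (P : probability Omega_borel R) : Prop :=
  forall (n : nat) (f : n.-tuple 'I_3 -> R[i]),
    cintegral P setT (fun w : Omega_borel => f [tuple w i | i < n]) =
    \sum_(v : n.-tuple 'I_3)
      f v * (\prod_(j < n) W (expn2pi (tau_iter (nth ord0 v) j.+1 x)))%:C.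

(* The coordinates of negative index are forced by the one of index 0. *)
Definition Phi_seq {R : realType} (x : R) (w : nat -> 'I_3) (n : int) : R[i] :=
  match n with
  | Posz n => expn2pi (tau_iter w n x)
  | Negz n => expn2pi x ^+ (3 ^ n.+1)
  end.

Lemma expn2pi_norm (R : realType) (x : R) : `|expn2pi x| = 1.
Proof.
by rewrite /expn2pi normc_def /= sqrrN cos2Dsin2 sqrtr1.
Qed.

Lemma expn2piD (R : realType) (x y : R) :
  expn2pi (x + y) = expn2pi x * expn2pi y.
Proof.
apply/eqP; rewrite eq_complex /expn2pi /= mulrDr cosD sinD.
apply/andP; split; apply/eqP; last by rewrite mulrN mulNr -opprD addrC.
by rewrite mulrNN.
Qed.

Lemma expn2pi_nat (R : realType) (k : nat) : expn2pi (k%:R : R) = 1.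
Proof.
elim: k => [|k IH]; first by rewrite /expn2pi mulr0 cos0 sin0 oppr0.
rewrite -natr1 expn2piD IH mul1r /expn2pi mulr1 mulr_natl.
by rewrite cos2pi sin2pi oppr0.
Qed.

Lemma expn2pi_tau (R : realType) (k : nat) (x : R) :
  expn2pi (tau k x) ^+ 3 = expn2pi x.
Proof.
rewrite !exprS expr0 mulr1 -!expn2piD.
rewrite (_ : tau k x + _ = x + k%:R); first by rewrite expn2piD expn2pi_nat mulr1.
have h : 3 * tau k x = x + k%:R by rewrite /tau mulrC divfK.
by rewrite -h; ring.
Qed.

Lemma Phi_subproof (R : realType) (x : R) (w : nat -> 'I_3) :
  Phi_seq x w \in solenoid_set R.
Proof.
rewrite inE /= => -[n|n]; split; rewrite /Phi_seq ?normrX ?expn2pi_norm ?expr1n //.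
- by rewrite -PoszD addn1 /= expn2pi_tau.
- case: n => [|n]; first by rewrite /= expn1.
  have -> : Negz n.+1 + 1 = Negz n by rewrite !NegzE -[n.+2]addn1 PoszD opprD addrNK.
  by rewrite -exprM -expnSr.
Qed.

Definition Phi {R : realType} (x : R) (w : nat -> 'I_3) : solenoid R :=
  exist (fun z => z \in solenoid_set R) (Phi_seq x w) (Phi_subproof x w).

Definition is_associated_measure {R : realType} (W : R[i] -> R)
    (m : probability (solenoid_borel R) R) : Prop :=
  exists P : R -> probability Omega_borel R,
    (forall x, 0 <= x < 1 -> is_path_measure W x (P x)) /\
    (forall f : solenoid R -> R[i], continuous f ->
       cintegral m setT f =
       cintegral lebesgue_measure `[0, 1[
         (fun x : R => cintegral (P x) setT (fun w : Omega_borel => f (Phi x w)))).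

Definition m0 {R : realType} (z : R[i]) : R[i] := (1 + z ^+ 2) / (Num.sqrt 2)%:C.

Definition W0 {R : realType} (z : R[i]) : R := ComplexField.Normc.normc (m0 z) ^+ 2 / 3.

Definition fourier {R : realType} (m : probability (solenoid_borel R) R)
    (k : int) (p : nat) : R[i] :=
  cintegral m setT (character k p).

(* Main.v *)
(* Let D_p be the set of integers below 3^p whose ternary digits are 0 or 2, and
   let N be the number of pairs d, d' in D_p with d + k = d'.  Both sides equal
   N / 2^p.  On the Hausdorff side C is the union of the pieces (C + d) / 3^p, so
   C + k / 3^p meets C in N such pieces, up to finitely many points; the
   lower bound pulls a cover back to [0, 1) along the map reading binary digits
   as ternary ones, which expands distances in the sense |t - u| <= |G t - G u|^s.
   On the Fourier side the transfer operator of W0 maps each character to a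
   multiple of one character, and this reduction modulo 3 of the frequency obeys
   the same recursion as N / 2^p. *)

Require Import Defs.
From mathcomp Require Import all_boot all_order all_algebra.
From mathcomp Require Import complex ring lra zify.
From mathcomp Require Import all_classical all_reals all_analysis.

Import Order.TTheory GRing.Theory Num.Theory.
Import numFieldNormedType.Exports.

Local Open Scope classical_set_scope.
Local Open Scope ring_scope.
Local Open Scope complex_scope.

Set Implicit Arguments.
Unset Strict Implicit.
Unset Printing Implicit Defensive.

(* The [p] low binary digits of [j], doubled and read in base 3. *)
Fixpoint digits (p j : nat) : nat :=
  if p is p'.+1 then (3 * digits p' j./2 + 2 * odd j)%N else 0%N.

Lemma digitsS p i (b : bool) :
  digits p.+1 (b + i.*2) = (3 * digits p i + 2 * b)%N.
Proof. by rewrite /= half_bit_double oddD odd_double addbF oddb. Qed.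

(** * Ternary expansions of points of the Cantor set *)

Section cantor.
Variable R : realType.
Implicit Types x c t u : R.

Lemma cantor_stage_itv n x : cantor_stage n x -> 0 <= x <= 1.
Proof.
elim: n x => [|n IH] x /=; first by rewrite in_itv.
by case=> -[y /IH hy <-]; lra.
Qed.

Lemma cantor_set_itv x : cantor_set x -> 0 <= x <= 1.
Proof. by move=> /(_ 0 I); exact: cantor_stage_itv. Qed.

Lemma cantor_set_third c (b : bool) :
  cantor_set c -> cantor_set ((c + 2 * b%:R) / 3).
Proof.
move=> hc [|n] _ /=.
  by rewrite in_itv /=; have := cantor_set_itv hc; case: b => /=; lra.
by case: b; [right|left]; exists c; rewrite ?mulr0 ?addr0 ?mulr1 //; exact: hc.
Qed.

Lemma cantor_set_split x : cantor_set x ->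
  exists b : bool, cantor_set (3 * x - 2 * b%:R).
Proof.
move=> hx; have h n : exists y (b : bool), cantor_stage n y /\ x = (y + 2 * b%:R) / 3.
  have [[y hy <-]|[y hy <-]] := hx n.+1 I.
    by exists y, false; rewrite mulr0 addr0.
  by exists y, true; rewrite mulr1.
(* The digit found above may vary with the stage [n]. As [y] lies in [0, 1], the value
   [(y + 2 * b) / 3] is at least 2/3 exactly when [b] is true, so comparing [x] with 2/3 gives one
   digit for all stages. *)
exists (2 / 3 <= x) => n _; have [y [b [hy xE]]] := h n.
suff -> : 3 * x - 2 * (2 / 3 <= x)%R%:R = y by [].
have := cantor_stage_itv hy.
by case: b xE => /= xE; case: (leP (2 / 3) x) => /= ?; lra.
Qed.

Lemma cantor_set_digits p j c : (j < 2 ^ p)%N -> cantor_set c ->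
  cantor_set ((c + (digits p j)%:R) / 3 ^+ p).
Proof.
elim: p j c => [|p IH] j c; first by rewrite addr0 expr0 divr1.
rewrite expnS => hj /(cantor_set_third (odd j)) /(IH j./2) h.
rewrite [digits _ _]/= natrD !natrM exprS.
suff -> : (c + (3 * (digits p j./2)%:R + 2 * (odd j)%:R)) / (3 * 3 ^+ p)
  = ((c + 2 * (odd j)%:R) / 3 + (digits p j./2)%:R) / 3 ^+ p by apply: h; lia.
by field; rewrite expf_neq0 // pnatr_eq0.
Qed.

Lemma cantor_set_digits_split p x : cantor_set x ->
  exists2 j, (j < 2 ^ p)%N & cantor_set (3 ^+ p * x - (digits p j)%:R).
Proof.
move=> hx; elim: p => [|p [j hj]]; first by exists 0%N; rewrite // mul1r subr0.
move=> /cantor_set_split[b hb]; exists (b + j.*2)%N.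
  by rewrite expnS; case: b {hb}; lia.
rewrite digitsS natrD !natrM exprS.
by move: hb; congr (cantor_set _); ring.
Qed.

(* Reading binary digits 0, 1 as ternary digits 0, 2: on [0, 1) this is a right
   inverse of the Cantor function. *)
Fixpoint cantor_approx (n : nat) t : R :=
  if n is n'.+1 then
    if t < 2^-1 then cantor_approx n' (2 * t) / 3
    else (2 + cantor_approx n' (2 * t - 1)) / 3
  else 0.

Definition cantor_point t : R := limn (cantor_approx ^~ t).

Lemma cantor_approx_itv n t : 0 <= cantor_approx n t <= 1.
Proof.
elim: n t => [|n IH] t /=; first by lra.
by case: ifP => _; have := IH (2 * t); have := IH (2 * t - 1); lra.
Qed.

Lemma cantor_approx_cvg t : cvgn (cantor_approx ^~ t).
Proof.
apply: nondecreasing_is_cvgn.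
  apply/nondecreasing_seqP => n; elim: n t => [|n IH] t.
    by have /andP[] := cantor_approx_itv 1 t.
  rewrite [X in X <= _]/= [X in _ <= X]/=.
  by case: ifP => _; have := IH (2 * t); have := IH (2 * t - 1); simpl; lra.
by exists 1 => _ [n _ <-]; have /andP[] := cantor_approx_itv n t.
Qed.

Lemma cantor_point_itv t : 0 <= cantor_point t <= 1.
Proof.
apply/andP; split.
  apply: limr_ge; first exact: cantor_approx_cvg.
  by apply: nearW => n; have /andP[] := cantor_approx_itv n t.
apply: limr_le; first exact: cantor_approx_cvg.
by apply: nearW => n; have /andP[] := cantor_approx_itv n t.
Qed.

Lemma cantor_point_half (b : bool) t : 0 <= t < 1 ->
  cantor_point ((t + b%:R) / 2) = (cantor_point t + 2 * b%:R) / 3.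
Proof.
move=> ht; apply/cvg_lim => //; rewrite -cvg_shiftS /=.
have -> : (fun n : nat => cantor_approx n.+1 ((t + b%:R) / 2)) =
    (fun n => (cantor_approx n t + 2 * b%:R) / 3).
  apply/funext => n /=; case: b => /=.
    rewrite ifN; last by lra.
    by rewrite (_ : 2 * _ - 1 = t) ?mulr1 1?addrC //; lra.
  rewrite ifT; last by lra.
  by rewrite (_ : 2 * _ = t) ?mulr0 ?addr0 //; lra.
by apply: cvgMr_tmp; apply: cvgD; [exact: cantor_approx_cvg|exact: cvg_cst].
Qed.

Lemma half_digit t : 0 <= t < 1 ->
  exists (b : bool) u, 0 <= u < 1 /\ t = (u + b%:R) / 2.
Proof.
move=> ht; exists (2^-1 <= t)%R, (2 * t - (2^-1 <= t)%R%:R).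
by case: (leP 2^-1 t) => /= ?; split; lra.
Qed.

Lemma cantor_point_cantor t : 0 <= t < 1 -> cantor_set (cantor_point t).
Proof.
move=> ht n _; elim: n t ht => [|n IH] t ht /=.
  by rewrite in_itv /= cantor_point_itv.
have [b [u [hu ->]]] := half_digit ht; rewrite cantor_point_half //.
by case: b; [right|left]; exists (cantor_point u);
  rewrite ?mulr0 ?addr0 ?mulr1 //; exact: IH.
Qed.

Lemma cantor_point_digits p j t : 0 <= t < 1 -> (j < 2 ^ p)%N ->
  cantor_point ((t + j%:R) / 2 ^+ p) = (cantor_point t + (digits p j)%:R) / 3 ^+ p.
Proof.
elim: p j t => [|p IH] j t ht.
  by rewrite expn0 ltnS leqn0 => /eqP ->; rewrite !addr0 !divr1.
rewrite expnS => hj.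
have -> : (t + j%:R) / 2 ^+ p.+1 = ((t + (odd j)%:R) / 2 + j./2%:R) / 2 ^+ p.
  have -> : j%:R = (odd j)%:R + 2 * (j./2)%:R :> R.
    by rewrite -natrM -natrD mul2n odd_double_half.
  rewrite exprS.
  by field; rewrite expf_neq0 // pnatr_eq0.
rewrite IH; [|by case: (odd j) => /=; lra|by lia].
rewrite cantor_point_half // [digits _ _]/= natrD !natrM exprS.
by field; rewrite expf_neq0 // pnatr_eq0.
Qed.

(** * The dimension exponent and the expansion estimate *)

Let s : R := ln 2 / ln 3.
(** The reciprocal of [s]. The estimate |t - u| <= |G t - G u|^s is proved in the form |t - u|^r <=
    |G t - G u|, since [r >= 1] makes the power convex. *)
Let r : R := ln 3 / ln 2.

Lemma ln2_gt0 : 0 < ln 2 :> R. Proof. by rewrite ln_gt0 // ltr1n. Qed.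
Lemma ln3_gt0 : 0 < ln 3 :> R. Proof. by rewrite ln_gt0 // ltr1n. Qed.

Lemma cantor_dim_gt0 : 0 < s.
Proof. by rewrite divr_gt0 ?ln2_gt0 ?ln3_gt0. Qed.

Lemma powR3_dim : 3 `^ s = 2.
Proof. by rewrite /powR pnatr_eq0 /= divfK ?gt_eqF ?ln3_gt0 // lnK ?posrE. Qed.

Lemma powR2_invdim : 2 `^ r = 3.
Proof. by rewrite /powR pnatr_eq0 /= divfK ?gt_eqF ?ln2_gt0 // lnK ?posrE. Qed.

Lemma invdim_ge1 : 1 <= r.
Proof. by rewrite ler_pdivlMr ?ln2_gt0 // mul1r ler_ln ?posrE // ler_nat. Qed.

Lemma powR_invdimK x : 0 <= x -> (x `^ r) `^ s = x.
Proof.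
move=> x0; rewrite -powRrM (_ : r * s = 1) ?powRr1 //.
by rewrite /r /s; field; rewrite !gt_eqF ?ln2_gt0 ?ln3_gt0.
Qed.

Lemma powR_dim_expr n : (3 ^- n) `^ s = 2 ^- n.
Proof.
have e : (3 ^+ n) `^ s = 2 ^+ n.
  by rewrite -powR_mulrn // powRAC powR3_dim powR_mulrn.
apply: (mulfI (x := (3 ^+ n) `^ s)); first by rewrite e expf_neq0 // pnatr_eq0.
by rewrite -powRM // divff ?expf_neq0 ?pnatr_eq0 // powR1 e divff // expf_neq0 // pnatr_eq0.
Qed.

Lemma powR_half x : 0 <= x -> (x / 2) `^ r = x `^ r / 3.
Proof.
move=> x0; suff -> : x `^ r = 3 * (x / 2) `^ r by field.
by rewrite -powR2_invdim -powRM ?divr_ge0 //; congr (_ `^ _); field.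
Qed.

Lemma powR_mid a b : 0 <= a -> 0 <= b -> ((a + b) / 2) `^ r <= (a `^ r + b `^ r) / 2.
Proof.
move=> a0 b0.
have h01 : 0 <= (2^-1 : R) <= 1 by lra.
have /andP[h0 h1] := h01.
have := @convex_powR R r invdim_ge1 (Itv01 h0 h1) a b.
rewrite !inE /= !in_itv /= a0 b0 => /(_ isT isT); rewrite !convRE => h.
have {h} : (2^-1 * a + (1 - 2^-1) * b) `^ r <=
  2^-1 * a `^ r + (1 - 2^-1) * b `^ r by exact: h.
rewrite (_ : 2^-1 * a + (1 - 2^-1) * b = (a + b) / 2); last by field.
by rewrite (_ : 2^-1 * a `^ r + _ = (a `^ r + b `^ r) / 2) //; field.
Qed.

Lemma powR_invdim_le1 t : 0 <= t <= 1 -> t `^ r <= 1.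
Proof.
move=> /andP[t0 t1]; have -> : 1 = 1 `^ r :> R by rewrite powR1.
by apply: ge0_ler_powR; rewrite ?nnegrE // (le_trans ler01 invdim_ge1).
Qed.

(** Unfolding one binary digit reduces an inequality about [cantor_point] to the same inequality at
    other points, so an induction has no base case. An error term supplies one: an error of 1 is
    harmless on [0, 1], and each unfolded digit at least halves the error. *)
Lemma le_of_le_halfX (a b : R) : (forall n, a <= b + 2^-1 ^+ n) -> a <= b.
Proof.
move=> h; apply/ler_addgt0Pr => e e0.
have /cvgrPdist_lt/(_ _ e0)[n _ /(_ n (leqnn n))] :
    (2^-1 ^+ n : R) @[n --> \oo] --> 0 by apply: cvg_expr; rewrite ger0_norm; lra.
rewrite sub0r normrN ger0_norm ?exprn_ge0 ?invr_ge0 // => hn.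
by have := h n; lra.
Qed.

Lemma cantor_point_ge t : 0 <= t < 1 -> t `^ r <= cantor_point t.
Proof.
move=> ht; apply: le_of_le_halfX => n; elim: n t ht => [|n IH] t ht.
  have := powR_invdim_le1 (t := t); have := cantor_point_itv t; rewrite expr0; lra.
have [b [u [hu ->]]] := half_digit ht; rewrite cantor_point_half // exprS.
have e0 : 0 <= 2^-1 ^+ n :> R by rewrite exprn_ge0 // invr_ge0.
(* In the lower half both sides scale by 1/3. In the upper half midpoint convexity leaves (g + 1) /
   2 <= (g + 2) / 3, true because g = [cantor_point u] is at most 1. *)
have := IH u hu; have := cantor_point_itv u; case: b => /=.
  have := powR_mid (a := u) (b := 1); rewrite powR1; lra.
by rewrite addr0 powR_half; lra.
Qed.

(** The mirror image of the previous bound: here the upper half scales and the lower half uses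
    convexity. *)
Lemma cantor_point_le t : 0 <= t < 1 -> (1 - t) `^ r <= 1 - cantor_point t.
Proof.
move=> ht; apply: le_of_le_halfX => n; elim: n t ht => [|n IH] t ht.
  have := powR_invdim_le1 (t := 1 - t); have := cantor_point_itv t; rewrite expr0; lra.
have [b [u [hu ->]]] := half_digit ht; rewrite cantor_point_half // exprS.
have e0 : 0 <= 2^-1 ^+ n :> R by rewrite exprn_ge0 // invr_ge0.
have := IH u hu; have := cantor_point_itv u; case: b => /=.
  by rewrite (_ : 1 - (u + 1) / 2 = (1 - u) / 2) ?powR_half; lra.
rewrite (_ : 1 - (u + 0) / 2 = ((1 - u) + 1) / 2); last lra.
have := powR_mid (a := 1 - u) (b := 1); rewrite powR1; lra.
Qed.

(* When [t] and [u] lie in different halves, convexity of [x `^ r] reduces the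
   claim to the two preceding lemmas; otherwise both sides scale by [1/3]. *)
Lemma cantor_point_expand t u : 0 <= t < 1 -> 0 <= u < 1 -> t <= u ->
  (u - t) `^ r <= `|cantor_point u - cantor_point t|.
Proof.
move=> ht hu htu; apply: le_of_le_halfX => n.
elim: n t u ht hu htu => [|n IH] t u ht hu htu.
  have := powR_invdim_le1 (t := u - t).
  have := normr_ge0 (cantor_point u - cantor_point t); rewrite expr0; lra.
have [b [t' [ht' et]]] := half_digit ht; have [c [u' [hu' eu]]] := half_digit hu.
rewrite et eu !cantor_point_half // exprS.
have e0 : 0 <= 2^-1 ^+ n :> R by rewrite exprn_ge0 // invr_ge0.
have [ebc|nbc] := eqVneq b c.
  rewrite -ebc (_ : (u' + b%:R) / 2 - (t' + b%:R) / 2 = (u' - t') / 2); last by field.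
  rewrite (_ : _ / 3 - _ = (cantor_point u' - cantor_point t') / 3); last by field.
  have htu' : t' <= u' by move: htu; rewrite et eu ebc; lra.
  rewrite powR_half; last by lra.
  rewrite normrM (ger0_norm (x := 3^-1)) ?invr_ge0 //.
  by have := IH _ _ ht' hu' htu'; lra.
have [bF cT] : b = false /\ c = true.
  by move: htu nbc; rewrite et eu; case: b {et} => //; case: c {eu} => //=; lra.
rewrite bF cT /= (_ : (u' + 1) / 2 - (t' + 0) / 2 = ((1 - t') + u') / 2); last by field.
have := powR_mid (a := 1 - t') (b := u').
have := cantor_point_le ht'; have := cantor_point_ge hu'.
have := cantor_point_itv t'; have := cantor_point_itv u'.
have := ler_norm ((cantor_point u' + 2 * 1) / 3 - (cantor_point t' + 2 * 0) / 3); lra.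
Qed.

End cantor.

(** * Diameters and covers *)

Section hausdorff.
Variable R : realType.
Implicit Types (A U : set R) (x s : R).

Lemma diam_ge0 U : (0 <= diam U)%E.
Proof. by apply: ereal_sup_ubound; left. Qed.

Lemma diam_ub U x y : U x -> U y -> (`|x - y|%:E <= diam U)%E.
Proof. by move=> Ux Uy; apply: ereal_sup_ubound; right; exists x, y. Qed.

Lemma diam_le U (l : R) : 0 <= l -> (forall x y, U x -> U y -> x <= y -> y - x <= l) ->
  (diam U <= l%:E)%E.
Proof.
move=> l0 h; apply: ge_ereal_sup => _ [->|[x [y [Ux Uy ->]]]]; rewrite lee_fin //.
have [xy|/ltW yx] := leP x y; first by rewrite distrC ger0_norm ?h // subr_ge0.
by rewrite ger0_norm ?h // subr_ge0.
Qed.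

Lemma diam_set0 : diam (@set0 R) = 0%E.
Proof. by apply/eqP; rewrite eq_le diam_ge0 andbT diam_le. Qed.

Lemma poweR_diam_le U (l s : R) : 0 <= s -> (diam U <= l%:E)%E ->
  (poweR (diam U) s <= (l `^ s)%:E)%E.
Proof.
move=> s0 h; rewrite -poweR_EFin; apply: gt0_ler_poweR => //.
  by rewrite in_itv /= diam_ge0 leey.
by rewrite in_itv /= (le_trans (diam_ge0 U) h) leey.
Qed.

(** The finite cover is padded to a sequence with empty sets, which add nothing because 0^s = 0 for
    [0 < s]. *)
Lemma hausdorff_pre_le_fin (I : finType) (U : I -> set R) s (delta : R) A :
  0 < s -> (forall i, (diam (U i) <= delta%:E)%E) -> 0 <= delta ->
  (forall x, A x -> exists i, U i x) ->
  (hausdorff_pre s delta A <= \sum_(i : I) poweR (diam (U i)) s)%E.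
Proof.
move=> s0 hd d0 hA; pose L := [seq U i | i <- enum I]; pose V n := nth set0 L n.
have sL : size L = #|I| by rewrite size_map -cardE.
have V0 n : (#|I| <= n)%N -> V n = set0 by move=> h; rewrite /V nth_default ?sL.
apply: ereal_inf_lbound; exists V; split.
- move=> x /hA[i Ux]; exists (enum_rank i) => //.
  by rewrite /V /L (nth_map i) ?nth_enum_rank // -cardE ltn_ord.
- move=> n; have [nI|/V0 ->] := ltnP n #|I|; last by rewrite diam_set0 lee_fin.
  by rewrite /V /L (nth_map (enum_val (Ordinal nI))) // -cardE.
rewrite (@nneseries_split _ _ 0 #|I|); last by move=> k _; exact: poweR_ge0.
rewrite [X in (_ + X)%E]eseries0 ?adde0; last first.
  by move=> i hi _; rewrite V0 ?diam_set0 ?poweR0r ?gt_eqF.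
rewrite add0n /V -sL -(big_nth set0 xpredT (fun u => poweR (diam u) s)) big_map big_enum.
exact: eq_bigl.
Qed.

(** Pulling back an arbitrary covering set gives a set that need not be measurable; this encloses it
    in an interval whose length is the bound on its diameter. *)
Lemma itv_hull (E : set R) (l : R) : (forall t u, E t -> E u -> t <= u -> u - t <= l) ->
  E `<=` `[inf E, inf E + l].
Proof.
move=> h t Et /=; rewrite in_itv /=.
have lb u : E u -> t - l <= u.
  move=> Eu; have [tu|/ltW ut] := leP t u.
    by have := h _ _ Et Et (lexx t); lra.
  by have := h _ _ Eu Et ut; lra.
apply/andP; split; first by apply: ge_inf => //; exists (t - l).
by rewrite -lerBlDr; apply: lb_le_inf; [exists t|].
Qed.

End hausdorff.

(** * The number of digit pairs with difference [k] *)

Definition shift_hit (p : nat) (k : int) (j : nat) : bool :=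
  [exists i : 'I_(2 ^ p), (digits p i)%:Z + k == digits p j].

(** A pair with d + k = d' is determined by d', so counting the [j] that are hit counts the
    pairs. *)
Definition shift_count (p : nat) (k : int) : nat :=
  \sum_(j < 2 ^ p) shift_hit p k j.

Lemma lebesgue_measure_dyadic (R : realType) p (J : nat -> bool) :
  lebesgue_measure (\big[setU/set0]_(j < 2 ^ p | J j)
    [set` `[j%:R / 2 ^+ p, (j.+1)%:R / 2 ^+ p[] : set R) =
  ((\sum_(j < 2 ^ p) J j)%N%:R / 2 ^+ p)%:E.
Proof.
have p0 : 0 < 2 ^+ p :> R by rewrite exprn_gt0.
rewrite measure_bigsetU_ord_cond; first last.
- apply/trivIsetP => i j _ _ ij; apply/seteqP; split => // x [] /=.
  rewrite !in_itv /= !ler_pdivrMr // !ltr_pdivlMr // => /andP[h1 h2] /andP[h3 h4].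
  have : (i < j.+1)%N by rewrite -(ltr_nat R); exact: le_lt_trans h1 h4.
  have : (j < i.+1)%N by rewrite -(ltr_nat R); exact: le_lt_trans h3 h2.
  by move=> a b; move/eqP: ij; apply; apply/val_inj => /=; lia.
- by move=> i _; exact: measurable_itv.
rewrite natr_sum mulr_suml -sumEFin big_mkcond /=; apply: eq_bigr => j _.
case: (J j); last by rewrite mul0r.
rewrite lebesgue_measure_itv /= lte_fin ltr_pM2r ?invr_gt0 // ltr_nat ltnSn.
by rewrite -EFinB -mulrBl -natrB // subSnn.
Qed.

(** * The two bounds for the Hausdorff measure of the intersection *)

Section cantor_hausdorff.
Variable R : realType.
Implicit Types x : R.
Let s : R := ln 2 / ln 3.

Lemma hausdorff_ge (lambda : R) k p : lambda = k%:~R / 3 ^+ p ->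
  (((shift_count p k)%:R / 2 ^+ p)%:E <=
    hausdorff s (translate cantor_set lambda `&` cantor_set))%E.
Proof.
(* A single scale is enough for a lower bound, the measure being a supremum over scales; scale 1
   also keeps all diameters finite. *)
move=> hl; apply: (@le_trans _ _
    (hausdorff_pre s 1 (translate cantor_set lambda `&` cantor_set))); last first.
  by apply: ereal_sup_ubound; exists 1 => /=.
apply: le_ereal_inf_tmp => _ [U [hU hd ->]].
(* By the expansion estimate the pullback [E i] has diameter at most [diam (U i) ^ s], so the sum
   over the cover becomes a sum of lengths of the intervals [T i]. *)
pose E i := [set t : R | 0 <= t < 1 /\ U i (cantor_point t)].
pose l i := fine (diam (U i)) `^ s.
have fd i : diam (U i) \is a fin_num.
  by rewrite ge0_fin_numE ?diam_ge0 // (le_lt_trans (hd i)) // ltry.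
pose T i : set R := [set` `[inf (E i), inf (E i) + l i]].
have hE i : E i `<=` T i.
  apply: itv_hull => t u [ht Ut] [hu Uu] tu.
  rewrite -[u - t]powR_invdimK ?subr_ge0 //.
  apply: ge0_ler_powR; rewrite ?nnegrE ?powR_ge0 ?fine_ge0 ?diam_ge0 //.
    exact/ltW/cantor_dim_gt0.
  apply: le_trans (cantor_point_expand ht hu tu) _.
  by rewrite -lee_fin fineK //; exact: diam_ub.
rewrite -(lebesgue_measure_dyadic R p (shift_hit p k)).
have -> : (\sum_(0 <= i <oo) poweR (diam (U i)) s)%E =
    (\sum_(0 <= i <oo) lebesgue_measure (T i))%E.
  apply: eq_eseriesr => i _; rewrite lebesgue_measure_itv /= lte_fin ltrDl.
  have l0 : 0 <= l i by exact: powR_ge0.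
  rewrite -EFinD addrAC subrr add0r -[diam _]fineK // poweR_EFin -/(l i).
  by case: (ltP 0 (l i)) => // h; congr EFin; apply/eqP; rewrite eq_le h.
apply: measure_sigma_subadditive.
- by move=> i; exact: measurable_itv.
- by apply: bigsetU_measurable => j _; exact: measurable_itv.
(* [cantor_point] maps the [j]-th dyadic interval into the [j]-th piece of the Cantor set. When [j]
   is hit from [i], that piece is the translate of the [i]-th one, so the image lies in the
   intersection and is covered by the [U n]. *)
rewrite -bigcup_seq_cond => t [j /= /andP[_ /existsP[i /eqP hij]]].
rewrite in_itv /= => htj.
have p0 : 0 < 2 ^+ p :> R by rewrite exprn_gt0.
have [u hu tE] : exists2 u : R, 0 <= u < 1 & t = (u + j%:R) / 2 ^+ p.
  exists (2 ^+ p * t - j%:R); last by rewrite subrK mulrC mulKf // gt_eqF.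
  by move: htj; rewrite ler_pdivrMr // ltr_pdivlMr // -natr1 mulrC; lra.
have ht : 0 <= t < 1.
  have j0 : 0 <= j%:R :> R by [].
  have : (j.+1%:R : R) <= 2 ^+ p by rewrite -natrX ler_nat.
  by rewrite -natr1 tE ler_pdivlMr // ltr_pdivrMr // mul0r mul1r; lra.
have : (translate cantor_set lambda `&` cantor_set) (cantor_point t).
  split; last exact: (cantor_point_cantor ht).
  exists ((cantor_point u + (digits p i)%:R) / 3 ^+ p).
    exact/cantor_set_digits/cantor_point_cantor.
  rewrite hl tE cantor_point_digits // -mulrDl -addrA; congr ((_ + _) / _).
  by rewrite -[RHS]/((Posz (digits p j))%:~R) -hij rmorphD.
by move=> /hU[n _ Un]; exists n => //; apply: hE; split.
Qed.

(** Let [x] lie in piece [j] and [x - lambda] in piece [i], with rescaled positions [y] and [z] in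
    [0, 1]. The integer [m] = d_i + k - d_j equals [y - z], so it is 0, 1 or -1. The value 0 is a
    hit; the values 1 and -1 force [y] to be 1 or 0, an endpoint of the hull of piece [j]. *)
Lemma translate_cantor_split (lambda : R) k p x : lambda = k%:~R / 3 ^+ p ->
  (translate cantor_set lambda `&` cantor_set) x ->
  exists2 j, (j < 2 ^ p)%N &
    (shift_hit p k j /\ cantor_set (3 ^+ p * x - (digits p j)%:R)) \/
    exists b : bool, x = ((digits p j)%:R + b%:R) / 3 ^+ p.
Proof.
move=> hl [[c hc cx] hx].
have p0 : 3 ^+ p != 0 :> R by rewrite expf_neq0 // pnatr_eq0.
have [j hj hy] := cantor_set_digits_split p hx; exists j => //.
have [i hi hz] := cantor_set_digits_split p hc.
have hy1 := cantor_set_itv hy; have hz1 := cantor_set_itv hz.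
set y := 3 ^+ p * x - _ in hy hy1 *; set z := 3 ^+ p * c - _ in hz hz1.
pose m : int := (digits p i)%:Z + k - (digits p j)%:Z.
have myz : m%:~R = y - z.
  rewrite /m /y /z -cx hl rmorphB rmorphD /= mulrDr (mulrC (3 ^+ p) (_ / _)) divfK //.
  by rewrite !pmulrn; ring.
have xE : x = ((digits p j)%:R + y) / 3 ^+ p.
  by rewrite /y addrC subrK mulrC mulKf.
have m1 : `|m| <= 1.
  by rewrite -(ler_int R) intr_norm myz ler_norml; lra.
have [m0|m0] := eqVneq m 0.
  left; split=> //; apply/existsP; exists (Ordinal hi) => /=.
  by rewrite -subr_eq0 -/m m0.
right; have [mE|mE] : m = 1 \/ m = -1 by lia.
  by exists true; rewrite xE; congr ((_ + _) / _); move: myz; rewrite mE /=; lra.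
exists false; rewrite xE; congr ((_ + _) / _); move: myz; rewrite mE /=; lra.
Qed.

Lemma hausdorff_le (lambda : R) k p : lambda = k%:~R / 3 ^+ p ->
  (hausdorff s (translate cantor_set lambda `&` cantor_set) <=
    ((shift_count p k)%:R / 2 ^+ p)%:E)%E.
Proof.
move=> hl; apply: ge_ereal_sup => _ [delta /= d0 <-].
have [n hn] : exists n, 3 ^- n <= delta.
  have /cvgrPdist_lt/(_ _ d0)[n _ /(_ n (leqnn n))] :
      (3^-1 ^+ n : R) @[n --> \oo] --> 0 by apply: cvg_expr; rewrite ger0_norm; lra.
  by rewrite sub0r normrN ger0_norm ?exprn_ge0 ?invr_ge0 // exprVn => /ltW; exists n.
have p0 m : 0 < 3 ^+ m :> R by rewrite exprn_gt0.
pose a (j i : nat) : R := ((digits p j)%:R + (digits n i)%:R / 3 ^+ n) / 3 ^+ p.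
(* Each hit piece is covered by 2^n intervals of length 3^-(n + p), each contributing 2^-(n + p), so
   the total is N / 2^p whatever [n] is. The exceptional endpoints are covered by singletons, of
   diameter 0. *)
pose U (w : ('I_(2 ^ p) * 'I_(2 ^ n)) + ('I_(2 ^ p) * bool)) : set R :=
  match w with
  | inl (j, i) => if shift_hit p k j then [set` `[a j i, a j i + 3 ^- (n + p)]] else set0
  | inr (j, b) => [set ((digits p j)%:R + b%:R) / 3 ^+ p]
  end.
have dl j i : (diam (U (inl (j, i))) <= (3 ^- (n + p))%:E)%E.
  rewrite /U; case: ifP => _; last by rewrite diam_set0 lee_fin invr_ge0 ltW.
  apply: diam_le => [|x y /=]; first by rewrite invr_ge0 ltW.
  by rewrite !in_itv /=; lra.
have dr w : diam (U (inr w)) = 0%E.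
  case: w => j b; apply/eqP; rewrite eq_le diam_ge0 andbT diam_le // => x y /= -> ->.
  by rewrite subrr.
apply: le_trans (@hausdorff_pre_le_fin _ _ U _ _ _ (cantor_dim_gt0 R) _ (ltW d0) _) _.
- case=> [[j i]|w]; last by rewrite dr lee_fin ltW.
  apply: le_trans (dl j i) _; rewrite lee_fin; apply: le_trans hn.
  rewrite lef_pV2 ?posrE // ler_weXn2l ?leq_addr //; lra.
- move=> x hx; have [j hj [[hk hy]|[b xE]]] := translate_cantor_split hl hx; last first.
    by exists (inr (Ordinal hj, b)).
  have [i hi hz] := cantor_set_digits_split n hy.
  exists (inl (Ordinal hj, Ordinal hi)); rewrite /U /= hk /= in_itv /=.
  have := cantor_set_itv hz; set z := _ - _; move=> hz1.
  have -> : x = a j i + z * 3 ^- (n + p).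
    rewrite /z /a exprD; field.
    by rewrite !gt_eqF.
  rewrite lerDl lerD2l mulr_ge0 ?invr_ge0 ?ler_piMl ?invr_ge0 ?(ltW (p0 _)) //; lra.
rewrite big_sumType /= [X in (_ + X)%E]big1 ?adde0; last first.
  by move=> w _; rewrite dr poweR0r // gt_eqF // cantor_dim_gt0.
rewrite (eq_bigr (fun w => poweR (diam (U (inl (w.1, w.2)))) s)); last by case.
rewrite -(pair_bigA _ (fun j i => poweR (diam (U (inl (j, i)))) s)) /=.
rewrite natr_sum mulr_suml -sumEFin; apply: lee_sum => j _.
apply: (@le_trans _ _ (\sum_(i < 2 ^ n) ((shift_hit p k j)%:R * 2 ^- (n + p))%:E)%E).
  apply: lee_sum => i _; case: ifP => hk; rewrite ?hk; last first.
    by rewrite diam_set0 poweR0r ?mul0r // gt_eqF // cantor_dim_gt0.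
  rewrite mul1r -powR_dim_expr; apply: poweR_diam_le; first exact/ltW/cantor_dim_gt0.
  by have := dl j i; rewrite /U hk.
rewrite sumEFin lee_fin sumr_const card_ord -[leLHS]mulr_natl natrX exprD.
rewrite le_eqVlt; apply/orP; left; apply/eqP; field.
by rewrite !expf_neq0 // pnatr_eq0.
Qed.

End cantor_hausdorff.

(** * The transfer operator of [W0] on characters *)

Section fourier.
Variable R : realType.
Implicit Types (x y : R) (q k : int).

Lemma expn2pi_neq0 x : expn2pi x != 0.
Proof. by rewrite -normr_gt0 expn2pi_norm ltr01. Qed.

Lemma expn2pi0 : expn2pi (0 : R) = 1.
Proof. exact: (expn2pi_nat R 0). Qed.

Lemma expn2piN x : expn2pi (- x) = (expn2pi x)^-1.
Proof.
apply: (mulfI (expn2pi_neq0 x)).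
by rewrite -expn2piD subrr expn2pi0 divff ?expn2pi_neq0.
Qed.

Lemma expn2pi_exprz x q : expn2pi x ^ q = expn2pi (q%:~R * x).
Proof.
have h n : expn2pi x ^+ n = expn2pi (n%:R * x).
  elim: n => [|n IH]; first by rewrite mul0r expn2pi0.
  by rewrite exprS IH -expn2piD -nat1r mulrDl mul1r.
case: q => n; first exact: h.
by rewrite NegzE -exprnN h rmorphN mulNr expn2piN.
Qed.

(** From |1 + e^(iy)|^2 = 2 + 2 cos y: the weight is a combination of the characters of frequency 0,
    2 and -2. *)
Lemma W0_expn2pi x :
  (W0 (expn2pi x))%:C = (2 + expn2pi x ^ 2 + expn2pi x ^ (-2)) / 6.
Proof.
rewrite /W0 /m0 -[expn2pi x ^+ 2]/(expn2pi x ^ 2) !expn2pi_exprz.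
have -> : (-2)%:~R * x = - (2%:~R * x) by rewrite rmorphN mulNr.
move: (2%:~R * x) => y; rewrite ComplexField.Normc.normcM ComplexField.Normc.normcV.
rewrite exprMn exprVn /expn2pi mulrN cosN sinN.
have := cos2Dsin2 (2 * pi * y); move: (cos _) (sin _) => c d cd.
rewrite /ComplexField.Normc.normc /= !sqr_sqrtr ?addr_ge0 ?sqr_ge0 //.
rewrite expr0n /= addr0 add0r sqrrN.
rewrite (_ : (1 + c) ^+ 2 + d ^+ 2 = 2 + 2 * c); last first.
  by transitivity (1 + 2 * c + (c ^+ 2 + d ^+ 2)); [|rewrite cd]; ring.
have e6 : (6 : R[i]) = 6%:C by rewrite -(rmorph_nat (real_complex R)).
have e2 : (2 : R[i]) = 2%:C by rewrite -(rmorph_nat (real_complex R)).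
apply: (canRL (mulfK _)); first by rewrite pnatr_eq0.
rewrite e6 e2; apply/eqP; rewrite eq_complex /=; apply/andP; by split; apply/eqP; field.
Qed.

(** The three points are z, w z and w^2 z for a primitive cube root of unity w, so only frequencies
    divisible by 3 survive the sum. *)
Lemma sum_third_roots x q :
  (\sum_(b < 3) expn2pi (tau b x) ^ (3 * q) = 3 * expn2pi x ^ q) *
  ((\sum_(b < 3) expn2pi (tau b x) ^ (3 * q + 1) = 0) *
  (\sum_(b < 3) expn2pi (tau b x) ^ (3 * q + 2) = 0)).
Proof.
have t b : expn2pi (tau b x) ^ (3 * q) = expn2pi x ^ q.
  by rewrite -exprz_exp -[expn2pi (tau b x) ^ 3]/(expn2pi _ ^+ 3) expn2pi_tau.
pose w := expn2pi (3^-1 : R); pose z := expn2pi (x / 3).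
have e b : expn2pi (tau b x) = w ^+ b * z.
  have -> : w ^+ b = w ^ b by [].
  by rewrite /w expn2pi_exprz -expn2piD; congr expn2pi; rewrite /tau mulrDl addrC.
have w3 : w ^+ 3 = 1.
  have := expn2pi_exprz 3^-1 3; rewrite -/w mulfV ?pnatr_eq0 // => h.
  by rewrite -[LHS]/(w ^ 3) h -[1]/(1%:R) expn2pi_nat.
have w1 : w != 1.
  (* If w = 1 then cos (2 pi / 3) = 1, and the double angle formula gives sin (pi / 3) = 0, against
     its positivity. *)
  apply/eqP => /(congr1 (@complex.Re R)).
  rewrite /w /expn2pi /= (_ : 2 * pi * 3^-1 = (pi / 3) *+ 2); last by field.
  rewrite cos_mulr2n => h; have := cos2Dsin2 (pi / 3 : R).
  have : 0 < sin (pi / 3 : R).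
    by apply: sin_gt0_pihalf; have := pi_gt0 R; lra.
  nra.
have ws : 1 + w + w ^+ 2 = 0.
  apply: (mulfI (x := w - 1)); first by rewrite subr_eq0.
  by transitivity (w ^+ 3 - 1); [ring|rewrite w3 subrr mulr0].
split; first by rewrite !big_ord_recl big_ord0 !t; ring.
have tz b : expn2pi (tau b x) != 0 by exact: expn2pi_neq0.
split.
  under eq_bigr do rewrite expfzDr // t expr1z e.
  rewrite !big_ord_recl big_ord0 /= expr0 mul1r expr1.
  transitivity (expn2pi x ^ q * z * (1 + w + w ^+ 2)); first by rewrite /bump /=; ring.
  by rewrite ws mulr0.
under eq_bigr do rewrite expfzDr // t -[_ ^ 2]/(_ ^+ 2) e.
rewrite !big_ord_recl big_ord0 /= expr0 mul1r expr1.
transitivity (expn2pi x ^ q * z ^+ 2 * (1 + w + w ^+ 2 + w * (w ^+ 3 - 1))).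
  by rewrite /bump /=; ring.
by rewrite ws w3 subrr mulr0 addr0 mulr0.
Qed.

(* Summing over the three inverse branches against [W0] maps a multiple of a
   character to a multiple of a single character. *)
Definition transfer_step (cq : R * int) : R * int :=
  let: (c, q) := cq in
  match (q %% 3)%Z with
  | Posz 0 => (c, (q %/ 3)%Z)
  | Posz 1 => (c / 2, (q %/ 3)%Z + 1)
  | _ => (c / 2, (q %/ 3)%Z)
  end.

Arguments transfer_step : simpl never.

Lemma transfer_stepE c q :
  (transfer_step (c, 3 * q) = (c, q)) *
  (transfer_step (c, 3 * q + 1) = (c / 2, q + 1)) *
  (transfer_step (c, 3 * q + 2) = (c / 2, q)).
Proof.
rewrite /transfer_step mulrC modzMl mulzK // !modzMDl !divzMDl //.
by rewrite !modz_small // !divz_small // !addr0.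
Qed.

Lemma residue3 k : exists q, [\/ k = 3 * q, k = 3 * q + 1 | k = 3 * q + 2].
Proof.
exists (k %/ 3)%Z; have := divz_eq k 3; rewrite mulrC => {1 3 5}->.
have : 0 <= (k %% 3)%Z by exact: modz_ge0.
have : (k %% 3)%Z < 3 by exact: ltz_pmod.
case: (k %% 3)%Z => // -[|[|[|]]] //= _ _.
- by apply: Or31; rewrite addr0.
- exact: Or32.
- exact: Or33.
Qed.

(** Multiplying by the weight spreads frequency [k] over [k], [k + 2] and [k - 2] with coefficients
    2/6, 1/6 and 1/6. These are distinct modulo 3, so exactly one survives, with factor 1 if it is
    [k] and 1/2 otherwise. *)
Lemma transfer_W0 cq x :
  \sum_(b < 3) (W0 (expn2pi (tau b x)))%:C * (cq.1%:C * expn2pi (tau b x) ^ cq.2) =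
  (transfer_step cq).1%:C * expn2pi x ^ (transfer_step cq).2.
Proof.
case: cq => c k /=; pose S n := \sum_(b < 3) expn2pi (tau b x) ^ n.
have -> : \sum_(b < 3) (W0 (expn2pi (tau b x)))%:C * (c%:C * expn2pi (tau b x) ^ k) =
    c%:C / 6 * (2 * S k + S (k + 2) + S (k - 2)).
  rewrite /S mulr_sumr -!big_split /= mulr_sumr; apply: eq_bigr => b _.
  rewrite W0_expn2pi !expfzDr ?expn2pi_neq0 //; ring.
have h2 : (c / 2)%:C = c%:C / 2.
  by rewrite rmorphM /= fmorphV rmorph_nat.
have [q] := residue3 k; case=> ->; rewrite transfer_stepE /=.
- rewrite (_ : 3 * q - 2 = 3 * (q - 1) + 1) /S ?sum_third_roots; last by lia.
  by field.
- rewrite (_ : 3 * q + 1 + 2 = 3 * (q + 1)); last by lia.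
  rewrite (_ : 3 * q + 1 - 2 = 3 * (q - 1) + 2) /S ?sum_third_roots; last by lia.
  by rewrite h2; field.
- rewrite (_ : 3 * q + 2 + 2 = 3 * (q + 1) + 1); last by lia.
  rewrite (_ : 3 * q + 2 - 2 = 3 * q) /S ?sum_third_roots; last by lia.
  by rewrite h2; field.
Qed.

(** * Integrals of characters against the path measures *)

Lemma tau_iterS (w : nat -> 'I_3) n x :
  tau_iter w n.+1 x = tau_iter (fun i => w i.+1) n (tau (w 0%N) x).
Proof. by elim: n => // n IH; rewrite [LHS]/= -/(tau_iter w n.+1 x) IH. Qed.

Lemma eq_tau_iter (v w : nat -> 'I_3) n x : (forall i, (i < n)%N -> v i = w i) ->
  tau_iter v n x = tau_iter w n x.
Proof.
elim: n => //= n IH h; rewrite h // IH // => i hi; exact/h/ltnW.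
Qed.

Lemma big_tuple_cons (V : nmodType) (T : finType) n (F : n.+1.-tuple T -> V) :
  \sum_(v : n.+1.-tuple T) F v = \sum_(b : T) \sum_(v : n.-tuple T) F (cons_tuple b v).
Proof.
rewrite pair_bigA /= (reindex (fun bv : T * n.-tuple T => cons_tuple bv.1 bv.2)) //=.
exists (fun v => (thead v, behead_tuple v)) => [[b v] _ | v _] /=.
  by congr pair; apply/val_inj.
by rewrite [RHS]tuple_eta; apply/val_inj.
Qed.

(** The path sum is the transfer operator applied [p] times: splitting off the first digit [b]
    leaves the path sum based at [tau b x]. *)
Lemma path_sum_character p k x :
  \sum_(v : p.-tuple 'I_3) expn2pi (tau_iter (nth ord0 v) p x) ^ k *
    (\prod_(j < p) W0 (expn2pi (tau_iter (nth ord0 v) j.+1 x)))%:C =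
  (iter p transfer_step (1, k)).1%:C * expn2pi x ^ (iter p transfer_step (1, k)).2.
Proof.
elim: p x => [|p IH] x.
  rewrite (big_pred1 [tuple]) => [|v]; last by rewrite [v]tuple0 /= eqxx.
  by rewrite big_ord0 mulr1 mul1r.
rewrite big_tuple_cons iterS -transfer_W0; apply: eq_bigr => b _.
rewrite -IH mulr_sumr; apply: eq_bigr => v _.
have shift n : tau_iter (nth ord0 (cons_tuple b v)) n.+1 x =
    tau_iter (nth ord0 v) n (tau b x) by rewrite tau_iterS.
rewrite shift big_ord_recl shift [in LHS]rmorphM.
under eq_bigr do rewrite lift0 shift.
exact: mulrCA.
Qed.

Lemma cintegral_path_character k p x (P : probability Omega_borel R) :
  is_path_measure W0 x P ->
  cintegral P setT (fun w : Omega_borel => character k p (Phi x w)) =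
  (iter p transfer_step (1, k)).1%:C * expn2pi x ^ (iter p transfer_step (1, k)).2.
Proof.
move=> hP; pose f (v : p.-tuple 'I_3) := expn2pi (tau_iter (nth ord0 v) p x) ^ k.
(* The coordinate of index [p] depends only on the first [p] digits, so the defining formula of the
   path measure applies. *)
have -> : (fun w : Omega_borel => character k p (Phi x w)) =
    fun w : Omega_borel => f [tuple w i | i < p].
  apply/funext => w; have -> : character k p (Phi x w) = expn2pi (tau_iter w p x) ^ k by [].
  rewrite /f (@eq_tau_iter w (nth ord0 [tuple w i | i < p])) // => i hi.
  by rewrite (nth_map (Ordinal hi)) -?cardE ?card_ord // nth_enum_ord.
by rewrite hP -path_sum_character.
Qed.

(** * Orthogonality of characters on [0, 1) *)

Lemma Rintegral01_FTC (f F : R -> R) :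
  (forall x, is_derive x 1 F (f x)) -> continuous f ->
  \int[lebesgue_measure]_(x in `[0, 1[) f x = F 1 - F 0.
Proof.
move=> dF cf.
have cF : continuous F.
  by move=> x; apply/differentiable_continuous/derivable1_diffP/ex_derive.
have fint : lebesgue_measure.-integrable [set` `[(0 : R), 1]] (EFin \o f).
  apply: continuous_compact_integrable; first exact: segment_compact.
  exact: continuous_subspaceT.
rewrite Rintegral_itv_bndo_bndc; last first.
  apply: integrableS fint => //; exact: subset_itv_co_cc.
rewrite /Rintegral (@continuous_FTC2 _ f F) //.
- exact: continuous_subspaceT.
- split; first by move=> x _; apply: ex_derive.
  + by apply: cvg_at_right_filter; exact: cF.
  + by apply: cvg_at_left_filter; exact: cF.
- by move=> x _; rewrite derive1E; apply: derive_val.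
Qed.

Lemma cintegral_character (c : R) q :
  cintegral lebesgue_measure `[0, 1[ (fun x : R => c%:C * expn2pi x ^ q) =
  (if q == 0 then c else 0)%:C.
Proof.
pose th : R := 2 * pi * q%:~R.
have E x : expn2pi x ^ q = cos (th * x) -i* sin (th * x).
  by rewrite expn2pi_exprz /expn2pi /th !mulrA.
have [thc ths] : cos th = 1 /\ sin th = 0.
  have : expn2pi (1 : R) ^ q = 1 by rewrite (expn2pi_nat R 1) exp1rz.
  by rewrite E mulr1 => -[-> /eqP]; rewrite oppr_eq0 => /eqP ->.
have dlin a x : is_derive x 1 (fun y : R => a * y) a.
  by apply: is_derive_eq (is_deriveZ a (is_derive_id x 1)) _; rewrite /GRing.scale /= mulr1.
have dsin x : is_derive x 1 (fun y => sin (th * y)) (cos (th * x) * th).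
  exact: (is_derive1_comp (is_derive_sin (th * x)) (dlin th x)).
have dcos x : is_derive x 1 (fun y => cos (th * y)) (- sin (th * x) * th).
  exact: (is_derive1_comp (is_derive_cos (th * x)) (dlin th x)).
have cf (f f' : R -> R) : (forall x, is_derive x 1 f (f' x)) -> continuous (fun x => c * f x).
  move=> df x; apply: cvgMl_tmp.
  by have := df x => ?; apply/differentiable_continuous/derivable1_diffP/ex_derive.
have -> : cintegral lebesgue_measure `[0, 1[ (fun x : R => c%:C * expn2pi x ^ q) =
    (\int[lebesgue_measure]_(x in `[0, 1[) (c * cos (th * x))) +i*
    (\int[lebesgue_measure]_(x in `[0, 1[) (c * - sin (th * x))).
  by rewrite /cintegral; congr (_ +i* _); apply: eq_Rintegral => x _; rewrite E /=; ring.
have [q0|q0] := eqVneq q 0.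
  have th0 : th = 0 by rewrite /th q0 mulr0.
  have -> : (fun x : R => c * cos (th * x)) = fun=> c.
    by apply/funext => x; rewrite th0 mul0r cos0 mulr1.
  have -> : (fun x : R => c * - sin (th * x)) = fun=> 0.
    by apply/funext => x; rewrite th0 mul0r sin0 oppr0 mulr0.
  rewrite (Rintegral01_FTC (dlin c)); last by move=> x; exact: cvg_cst.
  rewrite (Rintegral01_FTC (fun x => is_derive_cst 0 x 1)); last by move=> x; exact: cvg_cst.
  by rewrite mulr0 mulr1 !subr0.
(* The antiderivatives divide by [th]; they take equal values at 0 and 1 because [th] is a multiple
   of 2 pi. *)
have th0 : th != 0 by rewrite /th !mulf_neq0 ?pnatr_eq0 ?intr_eq0 // gt_eqF ?pi_gt0.
have dS x : is_derive x 1 (fun y => c / th * sin (th * y)) (c * cos (th * x)).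
  by apply: is_derive_eq (is_deriveZ (c / th) (dsin x)) _; rewrite /GRing.scale /=; field.
have dC x : is_derive x 1 (fun y => c / th * cos (th * y)) (c * - sin (th * x)).
  by apply: is_derive_eq (is_deriveZ (c / th) (dcos x)) _; rewrite /GRing.scale /=; field.
rewrite (Rintegral01_FTC dS (cf _ _ dcos)) (Rintegral01_FTC dC); last first.
  move=> x; rewrite (_ : (fun _ => _) = (fun x => - (c * sin (th * x)))).
    by apply: cvgN; exact: (cf _ _ dsin).
  by apply/funext => y; rewrite mulrN.
by rewrite !mulr1 !mulr0 thc ths sin0 cos0 mulr0 !subrr.
Qed.

(** * The recursion for the number of digit pairs *)

Lemma sum_double (F : nat -> nat) n :
  (\sum_(j < n.*2) F j = \sum_(j < n) (F j.*2 + F (1 + j.*2)))%N.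
Proof.
elim: n => [|n IH]; first by rewrite !big_ord0.
by rewrite doubleS !big_ord_recr /= IH addnA.
Qed.

Lemma shift_hitP p k j :
  reflect (exists2 i, (i < 2 ^ p)%N & (digits p i)%:Z + k = digits p j) (shift_hit p k j).
Proof.
apply: (iffP existsP) => [[i /eqP h]|[i hi h]]; first by exists i.
by exists (Ordinal hi); apply/eqP.
Qed.

Lemma shift_hitS p k (b : bool) j :
  shift_hit p.+1 k (b + j.*2) <-> exists (a : bool) i, (i < 2 ^ p)%N /\
    3 * (digits p i)%:Z + 2 * a%:Z + k = 3 * (digits p j)%:Z + 2 * b%:Z.
Proof.
split=> [/shift_hitP[i hi]|[a [i [hi h]]]].
  rewrite digitsS => h; exists (odd i), (i./2); split; first by move: hi; rewrite expnS; lia.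
  by move: h; rewrite /=; lia.
apply/shift_hitP; exists (a + i.*2)%N; first by rewrite expnS; case: a {h}; lia.
by rewrite !digitsS; lia.
Qed.

(** Reduce 3 d + 2 a + k = 3 d' + 2 b modulo 3. Residue 0 of [k] forces a = b; residue 1 forces a =
    1 and b = 0, with a carry that turns [q] into [q + 1]; residue 2 forces a = 0 and b = 1. *)
Lemma shift_hit3 p q j (b : bool) :
  (shift_hit p.+1 (3 * q) (b + j.*2) = shift_hit p q j) *
  (shift_hit p.+1 (3 * q + 1) (b + j.*2) = ~~ b && shift_hit p (q + 1) j) *
  (shift_hit p.+1 (3 * q + 2) (b + j.*2) = b && shift_hit p q j).
Proof.
split; [split|]; apply/idP/idP.
- move=> /shift_hitS[a [i [hi h]]]; apply/shift_hitP; exists i => //.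
  by case: a b h => -[] /=; lia.
- move=> /shift_hitP[i hi h]; apply/shift_hitS; exists b, i; split => //; lia.
- move=> /shift_hitS[a [i [hi h]]]; apply/andP; split.
    by case: a b h => -[] //=; lia.
  by apply/shift_hitP; exists i => //; case: a b h => -[] /=; lia.
- move=> /andP[/negPf -> /shift_hitP[i hi h]]; apply/shift_hitS.
  by exists true, i; split => //=; lia.
- move=> /shift_hitS[a [i [hi h]]]; apply/andP; split.
    by case: a b h => -[] //=; lia.
  by apply/shift_hitP; exists i => //; case: a b h => -[] /=; lia.
- move=> /andP[-> /shift_hitP[i hi h]]; apply/shift_hitS.
  by exists false, i; split => //=; lia.
Qed.

(** For [k] divisible by 3 both values of the last digit [b] can be hit, which cancels the new
    factor 1/2; otherwise only one can and the factor stays, as in [transfer_step]. The coefficient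
    [c] is general because the first step already changes it. *)
Lemma shift_count_iter p k (c : R) :
  c * (shift_count p k)%:R / 2 ^+ p =
  if (iter p transfer_step (c, k)).2 == 0 then (iter p transfer_step (c, k)).1 else 0.
Proof.
elim: p k c => [|p IH] k c.
  rewrite /shift_count expn0 big_ord1 divr1 /=.
  have -> : shift_hit 0 k 0 = (k == 0).
    by apply/shift_hitP/eqP => [[i _]|->]; [rewrite /= add0r|exists 0%N].
  by case: eqP; rewrite ?mulr1 ?mulr0.
have nz : 2 ^+ p != 0 :> R by rewrite expf_neq0 // pnatr_eq0.
rewrite iterSr /shift_count expnS mul2n (sum_double (fun j => shift_hit p.+1 k j)) exprS.
have [q] := residue3 k; case=> ->; rewrite transfer_stepE -IH /shift_count.
- rewrite (eq_bigr (fun j : 'I_(2 ^ p) => 2 * shift_hit p q j)%N) => [|j _]; last first.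
    by rewrite (shift_hit3 p q j false) (shift_hit3 p q j true) addnn mul2n.
  by rewrite -big_distrr natrM /=; field.
- rewrite (eq_bigr (fun j : 'I_(2 ^ p) => shift_hit p (q + 1) j : nat)) => [|j _]; last first.
    by rewrite (shift_hit3 p q j false) (shift_hit3 p q j true) addn0.
  by field.
- rewrite (eq_bigr (fun j : 'I_(2 ^ p) => shift_hit p q j : nat)) => [|j _]; last first.
    by rewrite (shift_hit3 p q j false) (shift_hit3 p q j true) add0n.
  by field.
Qed.

Lemma character_continuous k p :
  continuous (character k p : solenoid R -> R[i]).
Proof.
have cc : continuous (fun z : solenoid R => Defs.coord z p).
  move=> z; apply: (@continuous_comp _ _ _
    (set_val : solenoid R -> prod_topology (fun _ : int => R[i]))
    (@proj int (fun=> R[i]) p)).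
    exact: initial_continuous.
  exact: (@proj_continuous int (fun=> R[i])).
have cX n : continuous (fun z : solenoid R => Defs.coord z p ^+ n).
  elim: n => [|n IH] z; first exact: (@cst_continuous (solenoid R) R[i] 1 z).
  rewrite (_ : (fun _ => _) = (fun z : solenoid R => Defs.coord z p * Defs.coord z p ^+ n)).
    exact: (cvgM (cc z) (IH z)).
  by apply/funext => w; rewrite exprS.
case: k => n; first exact: cX.
(* For a negative exponent inversion is continuous here because coordinates have modulus 1. *)
move=> z; apply: (cvgV _ (cX n.+1 z)).
rewrite expf_neq0 // -normr_eq0.
by have /set_mem /(_ p%:Z) [_ ->] := valP z; rewrite oner_eq0.
Qed.

End fourier.

Theorem lemma5p7 (R : realType) (m : probability (solenoid_borel R) R)
    (hm : is_associated_measure W0 m)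
    (lambda : R) (k : int) (p : nat) (hlambda : lambda = k%:~R / 3 ^+ p) :
  let s := ln 2 / ln 3 in
  let H := hausdorff s (translate cantor_set lambda `&` cantor_set) in
  H \is a fin_num /\ fourier m k p = (fine H)%:C.
Proof.
move=> s H.
have -> : H = ((shift_count p k)%:R / 2 ^+ p)%:E.
  by apply/eqP; rewrite eq_le hausdorff_le //= hausdorff_ge.
split=> //; have [P [hP mE]] := hm.
rewrite /fourier (mE _ (@character_continuous R k p)).
set cq := iter p (@transfer_step R) (1, k).
have eP x : `[0, 1[%classic x -> cintegral (P x) setT
    (fun w : Omega_borel => character k p (Phi x w)) = cq.1%:C * expn2pi x ^ cq.2.
  by rewrite /= in_itv /= => hx; apply: cintegral_path_character; exact: hP.
transitivity (cintegral lebesgue_measure `[0, 1[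
    (fun x : R => cq.1%:C * expn2pi x ^ cq.2)).
  rewrite /cintegral; congr (_ +i* _); apply: eq_Rintegral => x /set_mem hx.
    exact: (congr1 (@complex.Re R) (eP x hx)).
  exact: (congr1 (@complex.Im R) (eP x hx)).
(* The integral is the final coefficient if the final frequency is 0, and 0 otherwise; started from
   coefficient 1, this is N / 2^p. *)
by rewrite cintegral_character -shift_count_iter mul1r.
Qed.
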